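(* Every fractionally $\mathsf{tree}\text{-}\alpha$-fragile graph class has sublinear-weight clique-based separators. More precisely, if $\mathcal C$ is fractionally $\mathsf{tree}\text{-}\alpha$-fragile then, for every $c>0$, there exists $n_0$ such that every $n$-vertex graph $G\in\mathcal C$ with $n\ge n_0$ has a clique-based separator of weight at most $cn$.
   Context: All graphs are finite, simple and (unless stated otherwise) nonempty; $\mathbb N$ is the set of positive integers; $\alpha$ denotes independence number; $\log$ is base 2. A balanced separator of $G$ is a set $S\subseteq V(G)$ such that every connected component of $G-S$ has at most $2|V(G)|/3$ vertices. A clique-based separator of $G$ is a collection $\mathcal S$ of vertex-disjoint cliques of $G$ whose union is a balanced separator of $G$; its weight is $\sum_{C\in\mathcal S}\log(|C|+1)$. A class $\mathcal C$ has sublinear-weight clique-based separators if there is a function $h(n)=o(n)$ such that every $n$-vertex graph in $\mathcal C$ has a clique-based separator of weight at most $h(n)$. The tree-independence number $\mathsf{tree}\text{-}\alpha(G)$ is the minimum over all tree decompositions of $G$ of the maximum of $\alpha(G[X])$ over all bags $X$. For $0\le\beta\le 1$, a $\beta$-general cover of $G$ is a nonempty finite multiset $\mathcal A$ of subsets of $V(G)$ such that each vertex belongs to at least $\beta|\mathcal A|$ elements of $\mathcal A$ (counted with multiplicity); its $\mathsf{tree}\text{-}\alpha$-width is $\max_{A\in\mathcal A}\mathsf{tree}\text{-}\alpha(G[A])$ (the empty graph contributes value $0$). A graph class $\mathcal C$ is fractionally $\mathsf{tree}\text{-}\alpha$-fragile if there is a function $f\colon\mathbb N\to\mathbb N$ such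 that, for every $r\in\mathbb N$, every $G\in\mathcal C$ has a $(1-1/r)$-general cover with $\mathsf{tree}\text{-}\alpha$-width at most $f(r)$. *)

(* Defs.v *)
From HB Require Import structures.
From mathcomp Require Import all_boot all_order all_algebra.
From mathcomp Require Import all_classical all_reals all_analysis.

Set Implicit Arguments.
Unset Strict Implicit.
Unset Printing Implicit Defensive.

Import Order.TTheory GRing.Theory Num.Theory.
Import numFieldNormedType.Exports.

Local Open Scope ring_scope.

(* The vertex set may be empty: the empty graph is needed as an induced
   subgraph. Nonemptiness is assumed separately wherever it is intended. *)
Record sgraph := SGraph {
  svertex :> finType;
  sedge : rel svertex;
  sedge_sym : symmetric sedge;
  sedge_irr : irreflexive sedge }.

Definition graph_class := sgraph -> Prop.

Section Induced.
Variables (G : sgraph) (A : {set G}).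

Definition induced_edge : rel {x : G | x \in A} :=
  fun x y => sedge (val x) (val y).

Fact induced_sym : symmetric induced_edge.
Proof. by move=> x y; apply: sedge_sym. Qed.

Fact induced_irr : irreflexive induced_edge.
Proof. by move=> x; apply: sedge_irr. Qed.

Definition induced : sgraph := SGraph induced_sym induced_irr.

End Induced.

Definition components (G : sgraph) : {set {set G}} :=
  [set [set y | connect (@sedge G) x y] | x : G].

Definition connected_graph (G : sgraph) : Prop :=
  forall x y : G, connect (@sedge G) x y.

(* [ucycle] counts the two ends of an edge as a cycle of length 2; the cycles
   of a simple graph are those of length at least 3. *)
Definition acyclic_graph (G : sgraph) : Prop :=
  forall c : seq G, ucycle (@sedge G) c -> (size c <= 2)%N.

Definition is_tree (T : sgraph) : Prop :=
  [/\ (0 < #|T|)%N, connected_graph T & acyclic_graph T].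

Definition clique (G : sgraph) (A : {set G}) : bool :=
  [forall x in A, forall y in A, (x != y) ==> sedge x y].

Definition independent (G : sgraph) (A : {set G}) : bool :=
  [forall x in A, forall y in A, ~~ sedge x y].

Definition alpha (G : sgraph) : nat :=
  \max_(A : {set G} | independent A) #|A|.

Definition balanced_separator (G : sgraph) (S : {set G}) : Prop :=
  forall K, K \in components (induced (~: S)) ->
    (#|K|%:R <= 2 * #|G|%:R / 3 :> rat).

Definition clique_based_separator (G : sgraph) (S : {set {set G}}) : Prop :=
  [/\ finset.trivIset S,
      (forall A, A \in S -> clique A) &
      balanced_separator (finset.cover S)].

Definition log2 (R : realType) (x : R) : R := ln x / ln 2.

Definition weight (R : realType) (G : sgraph) (S : {set {set G}}) : R :=
  \sum_(A in S) log2 (#|A|%:R + 1).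

Definition sublinear_weight_clique_based_separators
    (R : realType) (C : graph_class) : Prop :=
  exists h : nat -> R,
    (h =o_\oo (fun n : nat => n%:R : R))%classic /\
    forall G, C G -> exists S : {set {set G}},
      clique_based_separator S /\ weight R S <= h #|G|.

Definition tree_decomposition (G T : sgraph) (bag : T -> {set G}) : Prop :=
  [/\ is_tree T,
      (forall v : G, exists t, v \in bag t),
      (forall u v : G, sedge u v -> exists t, (u \in bag t) && (v \in bag t)) &
      (forall v : G, connected_graph (induced [set t | v \in bag t]))].

Definition tree_decomposition_alpha (G T : sgraph) (bag : T -> {set G}) : nat :=
  \max_(t : T) alpha (induced (bag t)).

Definition tree_alpha_value (G : sgraph) (k : nat) : bool :=
  `[< exists (T : sgraph) (bag : T -> {set G}),
        tree_decomposition bag /\ tree_decomposition_alpha bag = k >].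

Fact tree_alpha_value_ex (G : sgraph) : exists k, tree_alpha_value G k.
Proof.
pose T := @SGraph unit (fun _ _ => false) (fun _ _ => erefl) (fun _ => erefl).
pose bag := fun _ : T => [set: G].
exists (tree_decomposition_alpha bag); apply/asboolP; exists T, bag; split=> //.
split.
- split; first by rewrite card_unit.
  + by move=> [] []; apply: connect0.
  + by move=> [|x [|y s]].
- by move=> v; exists tt; rewrite inE.
- by move=> u v _; exists tt; rewrite !inE.
- move=> v x y; have -> : x = y by apply: val_inj; case: (val x); case: (val y).
  exact: connect0.
Qed.

Definition tree_alpha (G : sgraph) : nat := ex_minn (tree_alpha_value_ex G).

(* The finite multiset of vertex subsets is given by a sequence, whose order
   is irrelevant. *)
Definition general_cover (R : realType) (beta : R) (G : sgraph)
    (A : seq {set G}) : Prop :=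
  A <> [::] /\
  forall v : G,
    beta * (size A)%:R <= (count (fun X : {set G} => v \in X) A)%:R.

Definition tree_alpha_width (G : sgraph) (A : seq {set G}) : nat :=
  \max_(X <- A) tree_alpha (induced X).

Definition fractionally_tree_alpha_fragile
    (R : realType) (C : graph_class) : Prop :=
  exists f : nat -> nat,
    (forall r, (0 < r)%N -> (0 < f r)%N) /\
    forall r, (0 < r)%N -> forall G, C G ->
      exists A : seq {set G},
        general_cover (1 - 1 / r%:R : R) A /\ (tree_alpha_width A <= f r)%N.

(* Main.v *)
From mathcomp Require Import all_boot all_order all_algebra.
From mathcomp Require Import all_classical all_reals all_analysis.
From mathcomp Require Import zify lra.
Require Import Defs.

Set Implicit Arguments.
Unset Strict Implicit.
Unset Printing Implicit Defensive.

Import Order.TTheory GRing.Theory Num.Theory.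
Import numFieldNormedType.Exports.

Local Open Scope ring_scope.

(** A fragile class allows a graph [G] on [n] vertices to be cut down, at the
cost of few vertices, to an induced subgraph of bounded tree-independence
number. Averaging over a [(1 - 1/r)]-general cover gives a member [X] of size at
least [(1 - 1/r) n] ([general_cover_large_member]); the at most [n/r] vertices
outside [X] go into the separator as singleton cliques, each of weight
[log2 2 = 1].

The graph [G[X]] has a tree decomposition whose bags have independence number at
most [k], where [k] depends on [r] only. As for every tree decomposition, one of
the bags, [B], leaves components of at most [|X|/2] vertices
([tree_decomposition_half_separator]). By Ramsey's theorem every set of at least
[2 ^ (s + k + 1)] vertices of [B] contains a clique of size [s], so removing such
cliques greedily splits [B] into at most [n/s] cliques of size [s] and boundedly
many singletons ([ramsey_clique_partition]). The resulting separator has weight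
at most

  [n / r + n (log2 (s + 1) / s) + 2 ^ (s + k + 1)].

Given [c], first [r] and [s] are chosen large to make each of the first two terms
at most [c n / 3]; the last term is then a constant, and is at most [c n / 3] for
large [n].

A single function [h] in [o(n)] is obtained from these bounds by diagonalization
([eventually_small_littleo]). *)

(** * Connectivity *)

(** An induction principle on walks that hides the underlying sequences: an
invariant need only be checked along single edges. *)
Lemma connect_propagate (V : finType) (e : rel V) (P : V -> Prop) :
  (forall x y, e x y -> P x -> P y) ->
  forall x y, connect e x y -> P x -> P y.
Proof.
move=> eP x y /connectP[p]; elim: p x => [|z p IHp] x /= => [_ -> //|].
by case/andP=> exz /IHp{}IHp ey Px; apply: (IHp ey); apply: eP Px.
Qed.

Lemma connect_homo (V W : finType) (e : rel V) (e' : rel W) (f : V -> W) :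
  (forall x y, e x y -> e' (f x) (f y)) ->
  forall x y, connect e x y -> connect e' (f x) (f y).
Proof.
move=> ef x y exy.
apply: (connect_propagate (P := fun z => connect e' (f x) (f z))) exy (connect0 _ _).
move=> a b eab xa; apply: connect_trans xa _; exact/connect1/ef.
Qed.

(** This compares components of iterated induced subgraphs without transporting
them along an isomorphism: homomorphic images of connected sets are connected,
so a component maps into a component. *)
Lemma leq_card_component_homo (G H : sgraph) (f : G -> H) :
  injective f -> (forall x y, sedge x y -> sedge (f x) (f y)) ->
  forall K, K \in components G ->
  exists2 K', K' \in components H & (#|K| <= #|K'|)%N.
Proof.
move=> f_inj fe _ /imsetP[x _ ->].
exists [set y | connect (@sedge H) (f x) y]; first exact: imset_f.
rewrite -(card_imset _ f_inj); apply/subset_leq_card/fintype.subsetP=> _ /imsetP[y + ->].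
rewrite !inE; exact: connect_homo.
Qed.

(** * A half-separating bag *)

Definition avoid (G : sgraph) (t : G) : rel G :=
  [rel x y | [&& x != t, y != t & sedge x y]].

(** Deleting the edge [ts] of a forest separates [t] from [s]. A walk avoiding
[t] or avoiding [s] does not use this edge, so the two walks meeting at [x] would
connect [s] to [t] in its absence, and a shortest such connection closes up with
[ts] to a cycle. *)
Lemma acyclic_avoid_meet (T : sgraph) (t s x : T) :
  acyclic_graph T -> sedge t s ->
  connect (avoid t) s x -> connect (avoid s) t x -> False.
Proof.
move=> Tacyc ets sx tx.
(* The forest without the edge between [t] and [s]. *)
pose e' : rel T := [rel a b | sedge a b &&
  ~~ (((a == t) && (b == s)) || ((a == s) && (b == t)))].
have e'_sym : symmetric e'.
  by move=> a b; rewrite /e' /= sedge_sym orbC [(b == s) && _]andbC [(b == t) && _]andbC.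
have sub_e' u : u \in [:: t; s] -> subrel (avoid u) e'.
  move=> u_ts a b /and3P[au bu ab]; rewrite /e' /= ab /=.
  move: u_ts; rewrite !inE => /orP[]/eqP <-.
    by rewrite (negPf au) (negPf bu) andbF.
  by rewrite (negPf au) (negPf bu) andbF.
have e'st : connect e' s t.
  apply: (@connect_trans _ _ x).
    apply: (connect_sub _ sx) => a b ab; apply/connect1/(sub_e' t) => //.
    by rewrite !inE eqxx.
  rewrite (sym_connect_sym e'_sym).
  apply: (connect_sub _ tx) => a b ab; apply/connect1/(sub_e' s) => //.
  by rewrite !inE eqxx orbT.
have nts : t != s by apply: contraTneq ets => ->; rewrite sedge_irr.
case/connectP: e'st => p /shortenP[q q_path q_uniq _] {p} tE.
have : ucycle (@sedge T) (s :: q).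
  rewrite /ucycle q_uniq andbT /= rcons_path -tE ets andbT.
  by apply: sub_path q_path => a b /andP[].
move/Tacyc.
case: q tE q_path {q_uniq} => [|a [|b q]] //=.
  by move=> tE; case/eqP: nts.
by move=> <-; rewrite /e' /= !eqxx orbT andbF.
Qed.

(** Iterating [f] eventually runs around a cycle of the graph; in a forest such a
cycle has length at most 2, and length 1 would be a loop. *)
Lemma acyclic_map_2cycle (T : sgraph) (f : T -> T) :
  (0 < #|T|)%N -> acyclic_graph T -> (forall t, sedge t (f t)) ->
  exists t, f (f t) = t.
Proof.
move=> /card_gt0P[x _] Tacyc fe.
have /trajectP[i lt_i iE] := looping_order f x.
pose y := iter i f x.
have y_cycle : fcycle f (orbit f y).
  apply/(orbitPcycle 0 3); exists (order f x - i).-1.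
  by rewrite prednK ?subn_gt0 // /y -iterD subnK 1?ltnW // iE.
exists y.
have : ucycle (@sedge T) (orbit f y).
  rewrite /ucycle orbit_uniq andbT.
  by apply: sub_cycle y_cycle => a b /eqP <-.
move/Tacyc; rewrite size_orbit.
move: y_cycle; rewrite /orbit; case: (order f y) (order_gt0 f y) => [|[|[|m]]] //= _.
  by rewrite andbT => /eqP fy; have := fe y; rewrite fy sedge_irr.
by case/and3P=> _ /eqP.
Qed.

(** A component of the graph left by a bag lives in a single branch of the tree at
the node [t]. The nodes whose bags contain a given vertex outside [bag t] form a
subtree avoiding [t], and adjacent vertices share a bag, so their subtrees lie in
the same component of the tree minus [t]. The witness [s] is the neighbour of
[t] in that component. *)
Lemma component_in_branch (G T : sgraph) (bag : T -> {set G}) (t : T)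
    (K : {set induced (~: bag t)}) :
  tree_decomposition bag -> K \in components (induced (~: bag t)) ->
  exists2 s, sedge t s &
    forall v, v \in K -> forall u, val v \in bag u -> connect (avoid t) s u.
Proof.
move=> [[_ Tconn _] bagV bagE bagC] /imsetP[x _ ->].
have outside (v : induced (~: bag t)) u : val v \in bag u -> u != t.
  by apply: contraTneq => ->; have := valP v; rewrite inE.
have [t0 x_t0] := bagV (val x).
have [s ets s_t0] : exists2 s, sedge t s & connect (avoid t) s t0.
  case/connectP: (Tconn t t0) => p /shortenP[[|s q] /= q_path q_uniq _] {p} t0E.
    by have := outside _ _ x_t0; rewrite t0E eqxx.
  case/andP: q_path => ets q_path; exists s => //.
  apply/connectP; exists q => //.
  case/andP: q_uniq => t_nsq _; move: t_nsq; rewrite inE negb_or.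
  elim: q s {ets t0E} q_path => //= a q IHq s /andP[sa aq].
  rewrite inE negb_or => /and3P[ts ta tq].
  by rewrite /avoid /= [s == t]eq_sym [a == t]eq_sym ts ta sa /=; apply: IHq => //; rewrite ta.
exists s => //.
pose P (v : induced (~: bag t)) :=
  forall u, val v \in bag u -> connect (avoid t) s u.
have P_spread (v : induced (~: bag t)) u0 :
    val v \in bag u0 -> connect (avoid t) s u0 -> P v.
  move=> v_u0 s_u0 u v_u; apply: connect_trans s_u0 _.
  have v_u0' : u0 \in [set w | val v \in bag w]%SET by rewrite inE.
  have v_u' : u \in [set w | val v \in bag w]%SET by rewrite inE.
  have := bagC (val v) (Sub u0 v_u0') (Sub u v_u').
  apply: (connect_homo (f := val)) => a b ab.
  have {}ab : sedge (val a) (val b) := ab.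
  rewrite /avoid /= ab andbT.
  by rewrite !(outside v) //; [have := valP b | have := valP a]; rewrite inE.
move=> v; rewrite inE => xv.
apply: (connect_propagate (P := P) _ xv); last exact: P_spread x_t0 s_t0.
move=> a b ab Pa.
have [u /andP[a_u b_u]] := bagE _ _ ab.
by apply: (P_spread b u) => //; apply: Pa.
Qed.

(** If every bag left a component with more than half of the vertices, each node
could be oriented towards the neighbour whose branch contains that component.
Some edge [ts] of the tree would then be oriented both ways. The two heavy
components live on opposite sides of [ts], so they are disjoint, and together
they would have more vertices than the graph. *)
Lemma tree_decomposition_half_separator (G T : sgraph) (bag : T -> {set G}) :
  tree_decomposition bag ->
  exists t, forall K, K \in components (induced (~: bag t)) ->
    (2 * #|K| <= #|G|)%N.
Proof.
move=> dec; have [[T_gt0 _ Tacyc] bagV _ _] := dec.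
apply: contrapT => /forallNP no_sep.
have heavy t : exists s, sedge t s /\ exists K : {set G}, (#|G| < 2 * #|K|)%N /\
    forall v, v \in K -> forall u, v \in bag u -> connect (avoid t) s u.
  have /existsNP[K /not_implyP[K_comp /negP]] := no_sep t.
  rewrite -ltnNge => K_big.
  have [s ets sK] := component_in_branch dec K_comp.
  exists s; split=> //; exists (val @: K); split.
    by rewrite card_imset //; apply: val_inj.
  by move=> _ /imsetP[v vK ->] u; apply: sK.
have [f fP] := choice heavy.
have [t ftt] := acyclic_map_2cycle T_gt0 Tacyc (fun t => proj1 (fP t)).
have [ets [K [K_big KP]]] := fP t.
have [_ [L [L_big LP]]] := fP (f t).
suff KL0 : K :&: L = finset.set0.
  have := cardsUI K L; rewrite KL0 cards0 addn0.
  have : (#|K :|: L| <= #|G|)%N by apply: max_card.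
  by lia.
apply/setP=> v; rewrite !inE; apply/negP=> /andP[vK vL].
have [u vu] := bagV v.
apply: (acyclic_avoid_meet Tacyc ets); first exact: KP vu.
by rewrite -{2}ftt; apply: LP vu.
Qed.

(** * Partitions into cliques *)

(** Independence may be tested in any induced subgraph containing the set. This
moves independent sets down to a subgraph induced in an induced subgraph. *)
Lemma independent_induced (G : sgraph) (X I : {set G}) :
  I \subset X -> independent I ->
  exists2 J : {set induced X}, independent J & val @: J = I.
Proof.
move=> IX I_ind; exists [set x | val x \in I]%SET.
  apply/forall_inP=> x; rewrite inE => xI; apply/forall_inP=> y; rewrite inE => yI.
  by have /forall_inP/(_ _ xI)/forall_inP/(_ _ yI) := I_ind.
apply/setP=> v; apply/imsetP/idP => [[x + ->]|vI]; first by rewrite inE.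
by exists (Sub v (fintype.subsetP IX v vI)); rewrite ?inE.
Qed.

Lemma le_alpha_induced (G : sgraph) (X I : {set G}) :
  I \subset X -> independent I -> (#|I| <= alpha (induced X))%N.
Proof.
move=> IX /(independent_induced IX)[J J_ind <-].
rewrite card_imset; last exact: val_inj.
exact: (@leq_bigmax_cond _ _ (fun A : {set induced X} => #|A|)).
Qed.

(** Ramsey's theorem, with a non-optimal bound that has a short proof: among the
other vertices of [A], the neighbours or the non-neighbours of a vertex [v] make
up at least half of the bound, and [v] extends the clique found among the former
or the independent set found among the latter. *)
Lemma ramsey (G : sgraph) (s t : nat) (A : {set G}) :
  (2 ^ (s + t) <= #|A|)%N ->
  exists2 C : {set G}, C \subset A &
    clique C /\ #|C| = s \/ independent C /\ #|C| = t.
Proof.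
(* The empty set serves when [s] or [t] is zero. *)
have triv (A' : {set G}) : exists2 C : {set G}, C \subset A' &
    [/\ clique C, independent C & #|C| = 0%N].
  exists finset.set0; rewrite ?finset.sub0set ?cards0 //.
  by split=> //; apply/forall_inP=> x; rewrite inE.
move: {2}(s + t)%N (leqnn (s + t)) => n.
elim: n s t A => [|n IHn] [|s] [|t] A // le_n A_big;
  try by have [C CA [? ? ?]] := triv A; exists C; [|left + right].
have /card_gt0P[v vA] : (0 < #|A|)%N by apply: leq_trans A_big; rewrite expn_gt0.
pose N := [set x in A | sedge v x]%SET.
pose M := [set x in A :\ v | ~~ sedge v x]%SET.
have A_NM : #|A| = (#|N| + #|M|).+1.
  rewrite (cardsD1 v) vA add1n; congr _.+1.
  rewrite -(cardsID [set x | sedge v x]%SET (A :\ v)); congr (_ + _)%N.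
    congr #|pred_of_set _|; apply/setP=> x; rewrite !inE.
    by case: eqP => [->|] //=; rewrite sedge_irr andbF.
  congr #|pred_of_set _|; apply/setP=> x; rewrite !inE.
  by rewrite andbC.
have NA : N \subset A by apply/fintype.subsetP=> x; rewrite inE => /andP[].
have MA : M \subset A by apply/fintype.subsetP=> x; rewrite !inE -andbA => /and3P[].
have [N_big|N_small] := leqP (2 ^ (s + t.+1)) #|N|.
  have [//|C CN CP] := IHn s t.+1 N _ N_big.
  case: CP => [[C_cl C_s]|C_ind]; last first.
    by exists C; [exact: fintype.subset_trans NA | right].
  have vC : v \notin C.
    by apply/negP=> /(fintype.subsetP CN); rewrite inE sedge_irr andbF.
  have vCE x : x \in C -> sedge v x.
    by move/(fintype.subsetP CN); rewrite inE => /andP[].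
  exists (v |: C).
    by rewrite finset.subUset finset.sub1set vA; exact: fintype.subset_trans NA.
  left; split; last by rewrite cardsU1 vC C_s.
  apply/forall_inP=> x /setU1P[->|xC]; apply/forall_inP=> y /setU1P[->|yC].
  - by rewrite eqxx.
  - by rewrite vCE ?implybT.
  - by rewrite sedge_sym vCE ?implybT.
  - by have /forall_inP/(_ _ xC)/forall_inP/(_ _ yC) := C_cl.
have M_big : (2 ^ (s.+1 + t) <= #|M|)%N.
  by move: A_big N_small; rewrite A_NM addSn expnS addSnnS; lia.
have [|C CM CP] := IHn s.+1 t M _ M_big; first by rewrite addSnnS.
case: CP => [C_cl|[C_ind C_t]].
  by exists C; [exact: fintype.subset_trans MA | left].
have vC : v \notin C.
  by apply/negP=> /(fintype.subsetP CM); rewrite !inE eqxx.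
have vCE x : x \in C -> ~~ sedge v x.
  by move/(fintype.subsetP CM); rewrite inE => /andP[].
exists (v |: C).
  by rewrite finset.subUset finset.sub1set vA; exact: fintype.subset_trans MA.
right; split; last by rewrite cardsU1 vC C_t.
apply/forall_inP=> x /setU1P[->|xC]; apply/forall_inP=> y /setU1P[->|yC].
- by rewrite sedge_irr.
- exact: vCE.
- by rewrite sedge_sym vCE.
- by have /forall_inP/(_ _ xC)/forall_inP/(_ _ yC) := C_ind.
Qed.

Definition clique_partition (G : sgraph) (A : {set G}) (S : {set {set G}}) :=
  [/\ finset.trivIset S, (forall B, B \in S -> clique B) & finset.cover S = A].

Section Weight.
Variable R : realType.

Lemma log2_ge0 (n : nat) : 0 <= log2 (n%:R + 1 : R).
Proof.
by rewrite /log2 divr_ge0 // ln_ge0 // ?lerDr ?ler0n // ler1n.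
Qed.

Lemma log2_exp (m : nat) : log2 (2 ^+ m : R) = m%:R.
Proof.
rewrite /log2 lnXn // -[_ *+ m]mulr_natr -mulrA mulrC divfK //.
by rewrite gt_eqF // ln_gt0 // ltr1n.
Qed.

Lemma weightU_le (G : sgraph) (S S' : {set {set G}}) :
  weight R (S :|: S') <= weight R S + weight R S'.
Proof.
rewrite /weight (big_setID S) /= finset.setUK finset.setDUl finset.setDv finset.set0U.
rewrite lerD2l [leRHS](big_setID S) /= lerDr.
by apply: sumr_ge0 => B _; apply: log2_ge0.
Qed.

Lemma clique_partitionU (G : sgraph) (A A' : {set G}) S S' :
  [disjoint A & A'] -> clique_partition A S -> clique_partition A' S' ->
  clique_partition (A :|: A') (S :|: S').
Proof.
move=> AA' [/finset.trivIsetP S_triv S_cl coverS] [/finset.trivIsetP S'_triv S'_cl coverS'].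
rewrite -coverS -coverS' in AA' *.
have cross B B' : B \in S -> B' \in S' -> [disjoint B & B'].
  have sub_cover (S0 : {set {set G}}) B0 : B0 \in S0 -> B0 \subset finset.cover S0.
    by move=> BS0; apply: finset.bigcup_sup BS0.
  by move=> BS BS'; apply: disjointW AA'; apply: sub_cover.
split.
- apply/finset.trivIsetP=> B B' /setUP[BS|BS] /setUP[BS'|BS'].
  + exact: S_triv.
  + by move=> _; apply: cross.
  + by move=> _; rewrite disjoint_sym; apply: cross.
  + exact: S'_triv.
- by move=> B /setUP[]; [apply: S_cl | apply: S'_cl].
- apply/setP=> v; rewrite inE /finset.cover; apply/finset.bigcupP/orP.
    by case=> B /setUP[] BS vB; [left|right]; apply/finset.bigcupP; exists B.
  by case=> /finset.bigcupP[B BS vB]; exists B; rewrite // inE BS ?orbT.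
Qed.

Lemma clique_partition1 (G : sgraph) (C : {set G}) :
  clique C -> clique_partition C [set C]%SET.
Proof.
move=> C_cl; split.
- by apply/finset.trivIsetP=> B B' /set1P-> /set1P->; rewrite eqxx.
- by move=> B /set1P->.
- by rewrite /finset.cover big_set1.
Qed.

Lemma clique_partition_singletons (G : sgraph) (A : {set G}) :
  exists2 S, clique_partition A S & weight R S = #|A|%:R.
Proof.
exists [set [set v] | v in A]%SET; first split.
- apply/finset.trivIsetP=> _ _ /imsetP[v _ ->] /imsetP[w _ ->].
  by rewrite disjoints1 inE; apply: contraNN => /eqP->.
- move=> _ /imsetP[v _ ->].
  by apply/forall_inP=> x /set1P->; apply/forall_inP=> y /set1P->; rewrite eqxx.
- by rewrite cover_imset; apply/setP=> v; apply/finset.bigcupP/idP => [[w wA /set1P->]|vA] //;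
    exists v; rewrite ?inE.
rewrite /weight big_imset /=; last by move=> v w _ _ /set1_inj.
rewrite (eq_bigr (fun=> 1)) ?sumr_const // => v _.
by rewrite cards1 -[1 + 1]expr1 log2_exp.
Qed.

(** Cliques of size exactly [s] are removed greedily as long as Ramsey's theorem
provides them. Each removed vertex costs [log2 (s + 1) / s] and each of the
remaining ones, kept as singletons, costs 1. *)
Lemma ramsey_clique_partition (G : sgraph) (s k : nat) (A : {set G}) :
  (0 < s)%N ->
  (forall I : {set G}, I \subset A -> independent I -> (#|I| <= k)%N) ->
  exists2 S, clique_partition A S &
    weight R S <= #|A|%:R * (log2 (s%:R + 1) / s%:R) + 2 ^+ (s + k.+1).
Proof.
move=> s_gt0; have [n] := ubnP #|A|; elim: n A => // n IHn A /ltnSE-le_An A_ind.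
have rate_ge0 : 0 <= log2 (s%:R + 1) / s%:R :> R by rewrite divr_ge0 ?log2_ge0.
have [A_big|A_small] := leqP (2 ^ (s + k.+1)) #|A|; last first.
  have [S S_part S_weight] := clique_partition_singletons A; exists S => //.
  rewrite S_weight -natrX; apply: ler_wpDl; first by rewrite mulr_ge0.
  by rewrite ler_nat ltnW.
have [C CA [[C_cl C_s]|[C_ind C_k]]] := ramsey A_big; last first.
  by have := A_ind C CA C_ind; rewrite C_k ltnn.
have A_C : #|A| = (s + #|A :\: C|)%N.
  by rewrite -(cardsID C A) (finset.setIidPr CA) C_s.
have [||S S_part S_weight] := IHn (A :\: C).
- by lia.
- by move=> I IAC; apply: A_ind; apply: fintype.subset_trans IAC (finset.subsetDl _ _).
exists ([set C]%SET :|: S).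
  rewrite -[A](finset.setID A C) (finset.setIidPr CA).
  apply: clique_partitionU S_part; last exact: clique_partition1.
  by rewrite -finset.setI_eq0; apply/eqP/setP=> v; rewrite !inE; case: (v \in C).
apply: le_trans (weightU_le _ _) _.
rewrite {1}/weight big_set1 C_s A_C natrD mulrDl -addrA.
by rewrite mulrCA mulfV ?mulr1 ?lerD2l // pnatr_eq0 -lt0n.
Qed.

End Weight.

(** * Separators from a cover *)

Lemma card_induced (G : sgraph) (X : {set G}) : #|induced X| = #|X|.
Proof. by rewrite card_sig; apply: eq_card => v; rewrite inE. Qed.

(** Deleting the complement of [X] from [G] reduces separating [G] to separating
[G[X]], and half of [|X|] is below two thirds of [|G|]. *)
Lemma balanced_separator_lift (G : sgraph) (X : {set G}) (B : {set induced X}) :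
  (forall K, K \in components (induced (~: B)) ->
    (2 * #|K| <= #|induced X|)%N) ->
  balanced_separator (val @: B :|: ~: X).
Proof.
move=> B_half K K_comp; set S := val @: B :|: ~: X.
have inX (v : induced (~: S)) : val v \in X.
  by have := valP v; rewrite !inE negb_or negbK => /andP[].
have outB (v : induced (~: S)) : Sub (val v) (inX v) \in ~: B.
  have := valP v; rewrite !inE negb_or negbK => /andP[+ _].
  by apply: contraNN => vB; apply/imsetP; exists (Sub (val v) (inX v)).
pose f (v : induced (~: S)) : induced (~: B) := Sub (Sub (val v) (inX v)) (outB v).
have f_inj : injective f.
  by move=> u v /(congr1 (fun w => val (val w))) /= uv; apply: val_inj.
have [L L_comp KL] := leq_card_component_homo (f := f) f_inj (fun _ _ uv => uv) K_comp.
have := B_half L L_comp; rewrite card_induced => L_half.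
have XG : (#|X| <= #|G|)%N by apply: max_card.
have : (3 * #|K| <= 2 * #|G|)%N.
  by apply: leq_trans (leq_mul (leqnn 3) KL) _; lia.
by rewrite -(ler_nat rat) !natrM ler_pdivlMr // mulrC.
Qed.

Section Cover.
Variable R : realType.

(** Double counting of the pairs of a vertex and a member of the cover containing
it: the average size of a member is at least [beta |G|]. *)
Lemma general_cover_large_member (G : sgraph) (beta : R) (A : seq {set G}) :
  general_cover beta A -> exists2 X, X \in A & beta * #|G|%:R <= #|X|%:R.
Proof.
case=> A_ne A_cov; apply: contrapT => /forall2NP no_X.
have small X : X \in A -> #|X|%:R < beta * #|G|%:R.
  by move=> XA; case: (no_X X) => // /negP; rewrite -ltNge.
have count_sum : (\sum_(v : G) count (fun X : {set G} => v \in X) A = \sum_(X <- A) #|X|)%N.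
  under eq_bigr do rewrite -sum1_count big_mkcond /=.
  rewrite exchange_big /=; apply: eq_bigr => X _.
  by rewrite -big_mkcond sum1_card.
have : beta * (size A)%:R * #|G|%:R <= (\sum_(X <- A) #|X|)%:R.
  rewrite -count_sum natr_sum [leLHS]mulr_natr -sumr_const.
  by apply: ler_sum => v _; apply: A_cov.
apply/negP; rewrite -ltNge natr_sum.
have -> : beta * (size A)%:R * #|G|%:R = \sum_(X <- A) beta * #|G|%:R.
  by rewrite big_const_seq count_predT iter_addr_0 -[RHS]mulr_natr mulrAC.
case: A A_ne small {A_cov no_X count_sum} => // X A _ small.
rewrite !big_cons. apply: ltr_leD; first by rewrite small ?mem_head.
rewrite big_seq [leRHS]big_seq; apply: ler_sum => Y YA.
by rewrite ltW // small // inE YA orbT.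
Qed.

(** The separator consists of the cliques that partition the half-separating bag
of a large member [X] of the cover, and of the vertices outside [X]. *)
Lemma cover_clique_based_separator (G : sgraph) (A : seq {set G}) (r k s : nat) :
  (0 < s)%N -> general_cover (1 - 1 / r%:R : R) A -> (tree_alpha_width A <= k)%N ->
  exists2 S : {set {set G}}, clique_based_separator S &
    weight R S <= #|G|%:R * (1 / r%:R) + #|G|%:R * (log2 (s%:R + 1) / s%:R)
                  + 2 ^+ (s + k.+1).
Proof.
move=> s_gt0 A_cov A_width.
have [X XA X_big] := general_cover_large_member A_cov.
have : (tree_alpha (induced X) <= k)%N.
  by apply: leq_trans A_width; rewrite /tree_alpha_width (big_rem X) //= leq_maxl.
rewrite /tree_alpha; case: ex_minnP => _ /asboolP[T [bag [dec <-]]] _ bag_alpha.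
have [t t_half] := tree_decomposition_half_separator dec.
have [||S S_part S_weight] := @ramsey_clique_partition R G s k (val @: bag t).
- exact: s_gt0.
- move=> I IB I_ind.
  have IX : I \subset X.
    by apply: fintype.subset_trans IB _; apply/fintype.subsetP=> _ /imsetP[x _ ->]; apply: valP.
  have [J J_ind JI] := independent_induced IX I_ind.
  have JB : J \subset bag t.
    apply/fintype.subsetP=> x xJ; rewrite -(mem_imset _ _ val_inj).
    by apply: (fintype.subsetP IB); rewrite -JI imset_f.
  rewrite -JI card_imset; last exact: val_inj.
  apply: leq_trans (le_alpha_induced JB J_ind) _; apply: leq_trans bag_alpha.
  exact: (leq_bigmax t).
have [S' S'_part S'_weight] := clique_partition_singletons R (~: X).
have BX : [disjoint val @: bag t & ~: X].
  rewrite -finset.subsets_disjoint; apply/fintype.subsetP=> _ /imsetP[x _ ->].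
  exact: valP.
have [SS_triv SS_cl SS_cover] := clique_partitionU BX S_part S'_part.
exists (S :|: S').
  by split=> //; rewrite SS_cover; apply: balanced_separator_lift.
apply: le_trans (weightU_le _ _ _) _; rewrite addrC -addrA lerD //.
  have : #|X|%:R + #|~: X|%:R = #|G|%:R :> R by rewrite -natrD cardsC.
  by rewrite S'_weight; lra.
apply: le_trans S_weight _; rewrite lerD2r ler_wpM2r //.
  by rewrite divr_ge0 ?log2_ge0.
by rewrite ler_nat max_card.
Qed.

(** * Asymptotics *)

(** The logarithm is computed exactly when [s + 1] is a power of two, and
[m ^ 2 <= 2 (2 ^ m - 1)] shows that the quotient [m / (2 ^ m - 1)] is at most
[2 / m]. *)
Lemma exists_log2_le (c : R) : 0 < c ->
  exists2 s : nat, (0 < s)%N & log2 (s%:R + 1) / s%:R <= c.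
Proof.
move=> c_gt0.
have sqr_le m : (m * m <= 2 * (2 ^ m - 1))%N.
  by elim: m => // m IHm; have := expn_gt0 2 m; rewrite expnS; nia.
pose m := (Num.bound (2 / c)).+1.
have mc : 2 <= m%:R * c.
  rewrite -ler_pdivrMr // /m (le_trans (ltW (archi_boundP _))) ?ler_nat //.
  by rewrite divr_ge0 // ltW.
have s_gt0 : (0 < 2 ^ m - 1)%N by rewrite subn_gt0 -{1}(expn0 2) ltn_exp2l.
exists (2 ^ m - 1)%N => //.
rewrite natrB ?expn_gt0 // subrK natrX log2_exp.
have := sqr_le m; rewrite -(ler_nat R) !natrM natrB ?expn_gt0 // natrX => le_mm.
have s_pos : 0 < 2 ^+ m - 1 :> R.
  by rewrite -natrX -(natrB _ (expn_gt0 2 m)) ltr0n.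
rewrite ler_pdivrMr //.
have m_pos : 0 < m%:R :> R by rewrite ltr0n.
nra.
Qed.

Lemma fragile_small_weight (C : graph_class) :
  fractionally_tree_alpha_fragile R C ->
  forall c : R, 0 < c -> exists n0 : nat, forall G : sgraph, C G ->
    (n0 <= #|G|)%N -> exists S : {set {set G}},
      clique_based_separator S /\ weight R S <= c * #|G|%:R.
Proof.
move=> [f [_ f_cov]] c c_gt0.
have c3_gt0 : 0 < c / 3 by rewrite divr_gt0.
have [s s_gt0 s_rate] := exists_log2_le c3_gt0.
pose bound (x : R) := (Num.bound x).+1.
have boundP x : 0 <= x -> x <= (bound x)%:R.
  by move=> x_ge0; rewrite (le_trans (ltW (archi_boundP x_ge0))) ?ler_nat.
pose r := bound (3 / c).
have r_rate : 1 / r%:R <= c / 3.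
  rewrite ler_pdivrMr ?ltr0n // mulrC -ler_pdivrMr // invf_div.
  by rewrite mul1r boundP // divr_ge0 // ltW.
pose K : R := 2 ^+ (s + (f r).+1).
have K_ge0 : 0 <= K by rewrite exprn_ge0.
exists (bound (K / (c / 3))) => G CG G_big.
have [A [A_cov A_width]] := f_cov r isT G CG.
have [S S_sep S_weight] := cover_clique_based_separator s_gt0 A_cov A_width.
exists S; split=> //; apply: le_trans S_weight _.
have K_le : K <= c / 3 * #|G|%:R.
  rewrite mulrC -ler_pdivrMr // (le_trans (boundP _ _)) ?ler_nat //.
  by rewrite divr_ge0 // ltW.
have G_ge0 : 0 <= #|G|%:R :> R by [].
have le1 := ler_wpM2l G_ge0 r_rate; have le2 := ler_wpM2l G_ge0 s_rate.
rewrite -/K; lra.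
Qed.

(** All vertices taken as singletons bound the weight by [n] for every [n], so that
the bounding function below is defined on small graphs too. *)
Lemma trivial_separator (G : sgraph) :
  exists S : {set {set G}}, clique_based_separator S /\ weight R S <= #|G|%:R.
Proof.
have [S [S_triv S_cl S_cover] S_weight] := clique_partition_singletons R [set: G].
exists S; split; last by rewrite S_weight cardsT.
by split=> //; rewrite S_cover => K /imsetP[x _ _]; have := valP x; rewrite !inE.
Qed.

(** The value [h n] is [n / (j + 1)] for the largest [j <= n] for which this bound
satisfies [Q n]. Bounding [j] by [n] makes the maximum exist; every fixed [j]
is eventually allowed, hence [h] is [o(n)]. *)
Lemma eventually_small_littleo (Q : nat -> R -> Prop) :
  (forall n, Q n n%:R) ->
  (forall c : R, 0 < c -> exists n0, forall n, (n0 <= n)%N -> Q n (c * n%:R)) ->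
  exists h : nat -> R,
    (h =o_\oo (fun n : nat => n%:R : R))%classic /\ forall n, Q n (h n).
Proof.
move=> Q1 Qc.
pose P n j := `[< Q n (j.+1%:R^-1 * n%:R) >].
have P0 n : exists j, P n j && (j <= n)%N.
  by exists 0%N; rewrite andbT; apply/asboolP; rewrite invr1 mul1r.
have P_le n j : P n j && (j <= n)%N -> (j <= n)%N by case/andP.
pose J n := ex_maxn (P0 n) (P_le n).
exists (fun n => (J n).+1%:R^-1 * n%:R); split; last first.
  by move=> n; rewrite /J; case: ex_maxnP => j /andP[/asboolP].
apply/eqoP => c c_gt0.
pose j := Num.bound c^-1.
have [n0 n0P] := Qc j.+1%:R^-1 ltac:(by rewrite invr_gt0 ltr0n).
exists (maxn n0 j) => //= n; rewrite /= geq_max => /andP[n0n jn].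
have jJ : (j <= J n)%N.
  rewrite /J; case: ex_maxnP => i _; apply.
  by rewrite jn andbT; apply/asboolP/n0P.
rewrite normrM ler_wpM2r // ger0_norm ?invr_ge0 //.
rewrite invf_ple ?posrE ?ltr0n // (le_trans (ltW (archi_boundP _))) //.
  by rewrite invr_ge0 ltW.
by rewrite ler_nat ltnW // ltnS.
Qed.

End Cover.

Unset Implicit Arguments.

Theorem corollary6p3 (R : realType) (C : graph_class)
    (Cne : forall G : sgraph, C G -> (0 < #|G|)%N)
    (Cfrag : fractionally_tree_alpha_fragile R C) :
  sublinear_weight_clique_based_separators R C /\
  (forall c : R, 0 < c ->
    exists n0 : nat, forall G : sgraph, C G -> (n0 <= #|G|)%N ->
      exists S : {set {set G}},
        clique_based_separator S /\ weight R S <= c * #|G|%:R).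
Proof.
have small := fragile_small_weight Cfrag.
split=> //.
pose Q (n : nat) (w : R) := forall G, C G -> #|G| = n ->
  exists S : {set {set G}}, clique_based_separator S /\ weight R S <= w.
have [||h [h_o hQ]] := @eventually_small_littleo R Q.
- by move=> n G _ <-; apply: trivial_separator.
- move=> c /small[n0 n0P]; exists n0 => n n0n G CG Gn.
  by rewrite -Gn; apply: n0P; rewrite ?Gn.
by exists h; split=> // G CG; apply: (hQ #|G|).
Qed.
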